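(* For every cyclic formula $\phi$: (i) if $\mathsf{CHL}\vdash\Box\phi$ then $\mathsf{CHL}\vdash\Box^\bullet\phi$; (ii) if $\mathsf{CHL}\vdash\phi$ then $\mathsf{CHL}\vdash\Box^\bullet\phi$; (iii) if $\mathsf{CHL}\vdash\Box^\bullet\phi\to\phi$ then $\mathsf{CHL}\vdash\phi$.
   Context: Labels: $\bot,\top$ and propositional variables (arity 0), $\neg,\Box$ (arity 1), $\wedge,\vee,\to$ (arity 2). A graph is $\langle V,r,S,\lambda\rangle$ with $V$ finite, root $r$, labelling $\lambda$, $S:V\to V^{*}$ ordered successors (length = arity of label); every vertex reachable from $r$. A (cyclic) formula is a graph in which every cycle (closed path of pairwise distinct vertices along successors) contains a $\Box$-labelled vertex. Bisimulation: $aRa'$ implies equal labels and $i$-th successors related; $\simeq$ = bisimilarity relating roots. $\phi$ modalised in $p$: every path from root to a $p$-labelled vertex contains a $\Box$-labelled vertex; then $\digamma p.\phi$ identifies the root with all $p$-labelled vertices (keeping the root's label). $\mathsf{CHL}$: least set of cyclic formulas containing all substitution instances of propositional tautologies, all $\Box(\phi\to\psi)\to(\Box\phi\to\Box\psi)$, all $\phi\leftrightarrow\psi$ with $\phi\simeq\psi$, closed under modus ponens, necessitation and Löb's rule (from $\vdash\Box\phi\to\phi$ infer $\vdash\phi$). $\Box^\bullet\phi:=\digamma p.\Box(\phi\wedge p)$ with $p$ not occurring in $\phi$. *)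

(* Defs.v *)
From HB Require Import structures.
From mathcomp Require Import all_boot.

Set Implicit Arguments.
Unset Strict Implicit.
Unset Printing Implicit Defensive.

Inductive label : Type :=
  | Bot | Top | Var of nat | Neg | Box | And | Or | Imp.

Definition label_eqb (a b : label) : bool :=
  match a, b with
  | Bot, Bot | Top, Top | Neg, Neg | Box, Box
  | And, And | Or, Or | Imp, Imp => true
  | Var p, Var q => p == q
  | _, _ => false
  end.

Lemma label_eqP : Equality.axiom label_eqb.
Proof.
case=> [||p|||||] [||q|||||] /=; try by constructor.
by apply: (iffP eqP) => [->|[]].
Qed.

HB.instance Definition _ := hasDecEq.Build label label_eqP.

Definition arity (l : label) : nat :=
  match l with
  | Bot | Top | Var _ => 0
  | Neg | Box => 1
  | And | Or | Imp => 2
  end.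

Definition edge_of (V : finType) (succ : V -> seq V) : rel V :=
  fun v w => w \in succ v.

Record graph : Type := Graph {
  vertex : finType;
  groot : vertex;
  succ : vertex -> seq vertex;
  lab : vertex -> label;
  size_succ : forall v, size (succ v) = arity (lab v);
  reach : forall v, connect (edge_of succ) groot v
}.

Definition edge (G : graph) : rel (vertex G) := edge_of (@succ G).

Definition is_box (G : graph) : pred (vertex G) := fun v => lab v == Box.

Definition guarded (G : graph) : Prop :=
  forall c : seq (vertex G), c != [::] -> ucycle (@edge G) c ->
    has (@is_box G) c.

Record formula : Type := Formula {
  graph_of :> graph;
  formula_guarded : guarded graph_of
}.

Definition bisimulation (G H : graph)
    (R : vertex G -> vertex H -> Prop) : Prop :=
  forall a b, R a b ->
    lab a = lab b /\
    forall i, i < arity (lab a) -> R (nth a (succ a) i) (nth b (succ b) i).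

Definition bisimilar (G H : graph) : Prop :=
  exists2 R : vertex G -> vertex H -> Prop,
    bisimulation R & R (groot G) (groot H).

(* The graph with a new root labelled l whose i-th successor is the root of a
   disjoint copy of args i. The arguments are a function rather than a tuple
   since tuples live in too small a universe to contain formulas. *)
Section Node.
Variables (l : label) (args : 'I_(arity l) -> formula).

Definition node_vertex : finType :=
  option {i : 'I_(arity l) & vertex (args i)}.

Definition node_in (i : 'I_(arity l)) (v : vertex (args i)) : node_vertex :=
  Some (existT (fun i => Finite.sort (vertex (args i))) i v).

Definition node_lab (x : node_vertex) : label :=
  if x is Some (existT i v) then lab v else l.

Definition node_succ (x : node_vertex) : seq node_vertex :=
  if x is Some (existT i v) then [seq node_in w | w <- succ v]
  else [seq node_in (groot (args i)) | i <- enum 'I_(arity l)].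

Lemma node_size_succ x : size (node_succ x) = arity (node_lab x).
Proof.
case: x => [[i v]|] /=; first by rewrite size_map size_succ.
by rewrite size_map size_enum_ord.
Qed.

Lemma node_in_inj i : injective (@node_in i).
Proof.
move=> v w /Some_inj E.
by move/eqP: E; rewrite -tag_eqE /tag_eq /= eqxx /= tagged_asE => /eqP.
Qed.

Lemma node_reach x : connect (edge_of node_succ) None x.
Proof.
case: x => [[i v]|]; last exact: connect0.
apply: (@connect_trans _ _ (node_in (groot (args i)))).
  by apply: connect1; apply/mapP; exists i; rewrite ?mem_enum.
have /connectP[s + ->] := reach v.
elim: s (groot _) => [|y s IH] x /=; first by rewrite connect0.
case/andP=> xy /IH; apply: connect_trans; apply: connect1.
by apply/mapP; exists y.
Qed.

Definition node_graph : graph := Graph node_size_succ node_reach.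

Lemma node_edge_None x : ~~ @edge node_graph x None.
Proof. by case: x => [[i v]|]; apply/negP => /mapP[]. Qed.

Lemma node_path i v s : path (@edge node_graph) (@node_in i v) s ->
  exists2 t, s = map (@node_in i) t & path (@edge (args i)) v t.
Proof.
elim: s v => [|y s IH] v /=; first by exists [::].
case/andP=> /mapP[w vw ->] /IH[t -> wt].
by exists (w :: t) => //=; apply/andP.
Qed.

Lemma node_guarded : guarded node_graph.
Proof.
case=> // -[[i v]|] s _ /andP[]; last first.
  by rewrite /= rcons_path => /andP[_]; rewrite (negbTE (node_edge_None _)).
rewrite /= -/(node_in v) => /node_path[t].
case/lastP: t => [|t w] E; first by case: s E.
have [Es /node_in_inj <-] : s = map (@node_in i) t /\ node_in v = node_in w.
  by move/eqP: E; rewrite map_rcons eqseq_rcons => /andP[/eqP-> /eqP].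
move=> vt /andP[]; rewrite Es mem_map ?map_inj_uniq; try exact: node_in_inj.
move=> vNt ut.
change (has (@is_box node_graph) (map (@node_in i) (v :: t))).
rewrite has_map.
apply: (@formula_guarded (args i) (v :: t)) => //.
by rewrite /ucycle /= vt vNt.
Qed.

Definition node : formula := Formula node_guarded.

End Node.

Definition args0 (i : 'I_0) : formula := False_rect _ (notF (ltn_ord i)).
Definition args1 (phi : formula) (i : 'I_1) : formula := phi.
Definition args2 (phi psi : formula) (i : 'I_2) : formula :=
  if val i == 0 then phi else psi.

Definition fBot : formula := @node Bot args0.
Definition fTop : formula := @node Top args0.
Definition fVar (p : nat) : formula := @node (Var p) args0.
Definition fNeg (phi : formula) : formula := @node Neg (args1 phi).
Definition fBox (phi : formula) : formula := @node Box (args1 phi).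
Definition fAnd (phi psi : formula) : formula := @node And (args2 phi psi).
Definition fOr (phi psi : formula) : formula := @node Or (args2 phi psi).
Definition fImp (phi psi : formula) : formula := @node Imp (args2 phi psi).
Definition fIff (phi psi : formula) : formula :=
  fAnd (fImp phi psi) (fImp psi phi).

Definition modalised (p : nat) (phi : formula) : Prop :=
  forall s : seq (vertex phi), path (@edge phi) (groot phi) s ->
    lab (last (groot phi) s) = Var p -> has (@is_box phi) (groot phi :: s).

Lemma modalised_root p phi : modalised p phi -> lab (groot phi) != Var p.
Proof.
move=> H; apply/eqP => E; have := H [::] isT E.
by rewrite /= /is_box E.
Qed.

Lemma modalised_fBox p phi : modalised p (fBox phi).
Proof. by []. Qed.

(* The graph of digamma p.phi: since modalisedness keeps p off the root,
   identifying the root with the p-labelled vertices (which have no successors)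
   while keeping the root's label amounts to deleting the latter and
   redirecting their incoming edges to the root. *)
Section FixedPoint.
Variables (p : nat) (phi : formula) (Hp : modalised p phi).

Definition fp_vertex : finType := {v : vertex phi | lab v != Var p}.

Definition fp_root : fp_vertex :=
  exist (fun v => lab v != Var p) (groot phi) (modalised_root Hp).

Definition fp_class (v : vertex phi) : fp_vertex := insubd fp_root v.

Definition fp_succ (v : fp_vertex) : seq fp_vertex :=
  map fp_class (succ (val v)).

Definition fp_lab (v : fp_vertex) : label := lab (val v).

Lemma fp_size_succ v : size (fp_succ v) = arity (fp_lab v).
Proof. by rewrite size_map size_succ. Qed.

Lemma fp_classE v : val (fp_class v) = if lab v != Var p then v else groot phi.
Proof. exact: val_insubd. Qed.

Lemma edge_lab v w : @edge phi v w -> lab v != Var p.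
Proof.
move=> vw; apply/eqP => E; have := size_succ v.
by move/eqP; rewrite E size_eq0 => /eqP Es; move: vw; rewrite /edge /edge_of Es.
Qed.

Lemma fp_class_edge v w :
  @edge phi v w -> edge_of fp_succ (fp_class v) (fp_class w).
Proof.
move=> vw; apply: map_f.
by rewrite fp_classE (edge_lab vw).
Qed.

Lemma fp_reach v : connect (edge_of fp_succ) fp_root v.
Proof.
have <- : fp_class (groot phi) = fp_root.
  by apply: val_inj; rewrite fp_classE; case: ifP.
have <- : fp_class (val v) = v by rewrite /fp_class valKd.
have /connectP[s + ->] := reach (val v).
elim: s (groot _) => [|y s IH] x /=; first by rewrite connect0.
by case/andP=> /fp_class_edge/connect1 xy /IH; apply: connect_trans.
Qed.

Definition fp_graph : graph := Graph fp_size_succ fp_reach.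

Lemma fp_edgeP (v w : vertex fp_graph) : edge v w ->
  @edge phi (val v) (val w) \/
  (w = fp_root /\ exists2 u, @edge phi (val v) u & lab u = Var p).
Proof.
case/mapP=> u vu ->; case: (eqVneq (lab u) (Var p)) => E.
  right; split; last by exists u.
  by apply: val_inj; rewrite fp_classE E eqxx.
by left; rewrite fp_classE E.
Qed.

Lemma fp_path (v : vertex fp_graph) (s : seq (vertex fp_graph)) :
  fp_root \notin s -> path (@edge fp_graph) v s ->
  path (@edge phi) (val v) (map val s).
Proof.
elim: s v => //= w s IH v; rewrite inE negb_or => /andP[wr rs] /andP[vw ws].
rewrite IH // andbT.
by case: (fp_edgeP vw) => // -[E _]; rewrite E eqxx in wr.
Qed.

Lemma fp_has_box (c : seq (vertex fp_graph)) :
  has (@is_box phi) (map val c) = has (@is_box fp_graph) c.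
Proof. by rewrite has_map. Qed.

Lemma fp_guarded : guarded fp_graph.
Proof.
move=> c cN0 /andP[cc uc]; rewrite -fp_has_box.
have [rc|rNc] := boolP (fp_root \in c); last first.
  apply: formula_guarded; first by case: c cN0 {cc uc rNc}.
  rewrite /ucycle (map_inj_uniq val_inj) uc andbT.
  case: c {cN0 uc} cc rNc => //= x s xs rNc.
  rewrite -map_rcons; apply: fp_path => //.
  by rewrite mem_rcons.
have [i s Es] := rot_to rc.
rewrite -(has_rot i) -map_rot Es.
move: cc uc; rewrite -(rot_cycle i) -(rot_uniq i) Es /= rcons_path.
case/andP=> /[dup] rs0 rs lr /andP[rNs us].
have {}rs := fp_path rNs rs.
case: (fp_edgeP lr) => [e|[_ [u e lu]]].
  apply: (@formula_guarded phi (map val (fp_root :: s))) => //.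
  rewrite /ucycle (map_inj_uniq val_inj) cons_uniq rNs us andbT map_cons /cycle.
  by rewrite rcons_path rs last_map e.
have := Hp (s := rcons (map val s) u).
rewrite rcons_path rs last_rcons -[groot phi]/(val fp_root) last_map e.
move=> /(_ isT lu) /=; rewrite has_rcons.
by rewrite [is_box u]/is_box lu.
Qed.

Definition fp : formula := Formula fp_guarded.

End FixedPoint.

Definition fresh (p : nat) (phi : formula) : Prop :=
  forall v : vertex phi, lab v <> Var p.

Lemma exists_fresh phi : exists p, fresh p phi.
Proof.
pose idx (v : vertex phi) := if lab v is Var q then q else 0.
exists (\max_v idx v).+1 => v E.
by have := @leq_bigmax _ idx v; rewrite {1}/idx E ltnn.
Qed.

(* Only meaningful when p is fresh for phi; the result does not depend on the
   choice of such a p up to isomorphism of graphs. *)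
Definition fBoxb (p : nat) (phi : formula) : formula :=
  fp (@modalised_fBox p (fAnd phi (fVar p))).

Inductive prop_formula : Type :=
  | PBot | PTop | PVar of nat
  | PNeg of prop_formula
  | PAnd of prop_formula & prop_formula
  | POr of prop_formula & prop_formula
  | PImp of prop_formula & prop_formula.

Fixpoint eval (e : nat -> bool) (A : prop_formula) : bool :=
  match A with
  | PBot => false
  | PTop => true
  | PVar p => e p
  | PNeg A => ~~ eval e A
  | PAnd A B => eval e A && eval e B
  | POr A B => eval e A || eval e B
  | PImp A B => eval e A ==> eval e B
  end.

Definition tautology (A : prop_formula) : Prop := forall e, eval e A.

(* Every occurrence of a variable is replaced by its own copy of the
   substituted formula. Sharing copies would give a bisimilar graph, hence the
   same logic CHL. *)
Fixpoint instance (sigma : nat -> formula) (A : prop_formula) : formula :=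
  match A with
  | PBot => fBot
  | PTop => fTop
  | PVar p => sigma p
  | PNeg A => fNeg (instance sigma A)
  | PAnd A B => fAnd (instance sigma A) (instance sigma B)
  | POr A B => fOr (instance sigma A) (instance sigma B)
  | PImp A B => fImp (instance sigma A) (instance sigma B)
  end.

Inductive CHL : formula -> Prop :=
  | CHL_taut A sigma : tautology A -> CHL (instance sigma A)
  | CHL_K phi psi :
      CHL (fImp (fBox (fImp phi psi)) (fImp (fBox phi) (fBox psi)))
  | CHL_bisim (phi psi : formula) : bisimilar phi psi -> CHL (fIff phi psi)
  | CHL_mp phi psi : CHL phi -> CHL (fImp phi psi) -> CHL psi
  | CHL_nec phi : CHL phi -> CHL (fBox phi)
  | CHL_Loeb phi : CHL (fImp (fBox phi) phi) -> CHL phi.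

(* Main.v *)
Require Import Defs.
From mathcomp Require Import all_boot.

(** Writing [B] for the formula [fBoxb p phi], [B] is bisimilar to its one-step
    unfolding [Box (phi /\ B)], so CHL proves their equivalence. If [Box phi] is
    provable, this gives [Box B -> B]; if [B -> phi] is provable, then [B] and
    [phi /\ B] are equivalent, which again gives [Box B -> B]. In both cases
    Loeb's rule yields [B]. *)

Set Implicit Arguments.
Unset Strict Implicit.
Unset Printing Implicit Defensive.

Lemma nth_node_succ_root l (args : 'I_(arity l) -> formula) a i
    (lt_i : i < arity l) :
  nth a (node_succ (args := args) None) i =
  node_in (groot (args (Ordinal lt_i))).
Proof.
rewrite /= (nth_map (Ordinal lt_i)) ?size_enum_ord //.
by rewrite (nth_ord_enum _ (Ordinal lt_i)).
Qed.

Lemma nth_node_succ_in l (args : 'I_(arity l) -> formula) j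
    (v : vertex (args j)) a i : i < arity (lab v) ->
  nth a (node_succ (node_in v)) i = node_in (nth v (succ v) i).
Proof. by move=> lt_i; rewrite /= (nth_map v) ?size_succ. Qed.

(** This and the next two embeddings typecheck because [args1 psi ord0], [args2 psi chi ord0] and
    [args2 psi chi ord_max] reduce to the intended argument. *)
Definition box_in (psi : formula) (v : vertex psi) : vertex (fBox psi) :=
  @node_in Box (args1 psi) ord0 v.

Definition and_left (psi chi : formula) (v : vertex psi) :
    vertex (fAnd psi chi) :=
  @node_in And (args2 psi chi) ord0 v.

Definition and_right (psi chi : formula) (v : vertex chi) :
    vertex (fAnd psi chi) :=
  @node_in And (args2 psi chi) ord_max v.

Lemma nth_succ_box_root (psi : formula) (a : vertex (fBox psi)) :
  nth a (succ (groot (fBox psi))) 0 = box_in (groot psi).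
Proof.
rewrite [LHS](@nth_node_succ_root Box _ a 0 isT).
by rewrite (_ : Ordinal _ = ord0) //; exact: val_inj.
Qed.

Lemma nth_succ_box_in (psi : formula) (v : vertex psi) a i : i < arity (lab v) ->
  nth a (succ (box_in v)) i = box_in (nth v (succ v) i).
Proof. exact: (@nth_node_succ_in Box (args1 psi) ord0). Qed.

Lemma nth_succ_and_root0 (psi chi : formula) (a : vertex (fAnd psi chi)) :
  nth a (succ (groot (fAnd psi chi))) 0 = and_left chi (groot psi).
Proof.
rewrite [LHS](@nth_node_succ_root And _ a 0 isT).
by rewrite (_ : Ordinal _ = ord0) //; exact: val_inj.
Qed.

Lemma nth_succ_and_root1 (psi chi : formula) (a : vertex (fAnd psi chi)) :
  nth a (succ (groot (fAnd psi chi))) 1 = and_right psi (groot chi).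
Proof.
rewrite [LHS](@nth_node_succ_root And _ a 1 isT).
by rewrite (_ : Ordinal _ = ord_max) //; exact: val_inj.
Qed.

Lemma nth_succ_and_left (psi chi : formula) (v : vertex psi) a i : i < arity (lab v) ->
  nth a (succ (and_left chi v)) i = and_left chi (nth v (succ v) i).
Proof. exact: (@nth_node_succ_in And (args2 psi chi) ord0). Qed.

Lemma nth_succ_and_right (psi chi : formula) (v : vertex chi) a i : i < arity (lab v) ->
  nth a (succ (and_right psi v)) i = and_right psi (nth v (succ v) i).
Proof. exact: (@nth_node_succ_in And (args2 psi chi) ord_max). Qed.

Section Unfolding.
Variables (p : nat) (phi : formula) (Hp : fresh p phi).

Let B := fBoxb p phi.
Let body := fBox (fAnd phi (fVar p)).
Let unfolded := fBox (fAnd phi B).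

(** The quotient map of the fixed point: the [p]-leaf goes to the root, every vertex with another
    label to itself. *)
Let cls (v : vertex body) : vertex B := fp_class (@modalised_fBox p _) v.

Let nth_cls (v : vertex body) b i : lab v != Var p -> i < arity (lab v) ->
  nth b (@succ B (cls v)) i = cls (nth v (succ v) i).
Proof.
move=> v_p lt_i; rewrite /= /fp_succ fp_classE v_p.
by rewrite (nth_map v) ?size_succ.
Qed.

Let lab_cls (v : vertex body) : lab v != Var p -> @lab B (cls v) = lab v.
Proof. by move=> v_p; rewrite /= /fp_lab fp_classE v_p. Qed.

(** The outer layer of [unfolded] follows the layer of [B] from which it was copied, and the inner
    copy of [B] follows [B] identically. A vertex of [B] thus has a partner in each layer. *)
Inductive unfolding : vertex unfolded -> vertex B -> Prop :=
  | UnfoldRoot : unfolding (groot unfolded) (groot B)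
  | UnfoldAnd : unfolding (box_in (groot (fAnd phi B)))
                          (cls (box_in (groot (fAnd phi (fVar p)))))
  | UnfoldLeft v : unfolding (box_in (and_left B v))
                             (cls (box_in (and_left (fVar p) v)))
  | UnfoldRight w : unfolding (box_in (and_right phi w)) w.

Lemma bisimulation_unfolding : bisimulation unfolding.
Proof.
have root_cls : groot B = cls (groot body).
  by apply: val_inj; rewrite /cls fp_classE.
(* This is the back edge of [B]: where [B] returns to its root, [unfolded] enters the root of the
   inner copy. *)
have var_cls : cls (box_in (and_right phi (groot (fVar p)))) = groot B.
  by apply: val_inj; rewrite /cls fp_classE /= eqxx.
move=> _ _ [||v|w].
- split=> // -[|//] _; rewrite root_cls nth_cls // !nth_succ_box_root.
  exact: UnfoldAnd.
- split=> [|i lt_i]; first by rewrite lab_cls.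
  rewrite nth_cls // !nth_succ_box_in //.
  move: lt_i; case: i => [|[|//]] _.
    by rewrite !nth_succ_and_root0; exact: UnfoldLeft.
  by rewrite !nth_succ_and_root1 var_cls; exact: UnfoldRight.
(* Freshness keeps [cls] from collapsing vertices of [phi] to the root. *)
- have v_p : lab v != Var p by apply/eqP; exact: Hp.
  split=> [|i lt_i]; first by rewrite lab_cls.
  rewrite nth_cls // !nth_succ_box_in // !nth_succ_and_left //.
  exact: UnfoldLeft.
- split=> // i lt_i.
  by rewrite nth_succ_box_in // nth_succ_and_right //; exact: UnfoldRight.
Qed.

Lemma bisimilar_unfolding :
  bisimilar (fBox (fAnd phi (fBoxb p phi))) (fBoxb p phi).
Proof. exists unfolding; [exact: bisimulation_unfolding | exact: UnfoldRoot]. Qed.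

End Unfolding.

(* A sequence would be too small a universe for the formulas, hence a function. *)
Definition subst3 (a b c : formula) (n : nat) : formula :=
  match n with 0 => a | 1 => b | _ => c end.

(** With [subst3] the instance computes to the desired formula; schemata in two variables repeat
    [b]. *)
Lemma CHL_taut3 A a b c : tautology A -> CHL (instance (subst3 a b c) A).
Proof. exact: CHL_taut. Qed.

Lemma CHL_imp_trans a b c : CHL (fImp a b) -> CHL (fImp b c) -> CHL (fImp a c).
Proof.
have /(CHL_taut3 a b c) T : tautology
    (PImp (PImp (PVar 0) (PVar 1))
       (PImp (PImp (PVar 1) (PVar 2)) (PImp (PVar 0) (PVar 2)))).
  by move=> e /=; case: (e 0) (e 1) (e 2) => [] [] [].
by move=> ab bc; apply: CHL_mp bc _; apply: CHL_mp ab T.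
Qed.

Lemma CHL_iff_imp a b : CHL (fIff a b) -> CHL (fImp a b).
Proof.
have /(CHL_taut3 a b b) T : tautology
    (PImp (PAnd (PImp (PVar 0) (PVar 1)) (PImp (PVar 1) (PVar 0)))
       (PImp (PVar 0) (PVar 1))).
  by move=> e /=; case: (e 0) (e 1) => [] [].
by move=> ab; apply: CHL_mp ab T.
Qed.

Lemma CHL_and_intro a b : CHL (fImp a (fImp b (fAnd a b))).
Proof.
have T : tautology
    (PImp (PVar 0) (PImp (PVar 1) (PAnd (PVar 0) (PVar 1)))).
  by move=> e /=; case: (e 0) (e 1) => [] [].
exact: (CHL_taut3 a b b T).
Qed.

Lemma CHL_imp_and a b : CHL (fImp b a) -> CHL (fImp b (fAnd a b)).
Proof.
have /(CHL_taut3 a b b) T : tautology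
    (PImp (PImp (PVar 1) (PVar 0)) (PImp (PVar 1) (PAnd (PVar 0) (PVar 1)))).
  by move=> e /=; case: (e 0) (e 1) => [] [].
by move=> ba; apply: CHL_mp ba T.
Qed.

Lemma CHL_box_mono a b : CHL (fImp a b) -> CHL (fImp (fBox a) (fBox b)).
Proof. by move=> ab; apply: CHL_mp (CHL_nec ab) (CHL_K a b). Qed.

(** Boxing [a -> (b -> a /\ b)] and distributing once yields [Box (b -> a /\ b)] from [Box a];
    distributing again gives the claim. *)
Lemma CHL_box_imp_and a b :
  CHL (fBox a) -> CHL (fImp (fBox b) (fBox (fAnd a b))).
Proof.
move=> a_box; have := CHL_box_mono (CHL_and_intro a b).
by move/(CHL_mp a_box) => h; apply: CHL_mp h (CHL_K _ _).
Qed.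

(** Composing with the unfolding equivalence turns the hypothesis into the premise of Loeb's
    rule. *)
Lemma CHL_fBoxb_Loeb p phi : fresh p phi ->
  CHL (fImp (fBox (fBoxb p phi)) (fBox (fAnd phi (fBoxb p phi)))) ->
  CHL (fBoxb p phi).
Proof.
move=> Hp h; apply: CHL_Loeb; apply: CHL_imp_trans h _.
exact/CHL_iff_imp/CHL_bisim/bisimilar_unfolding.
Qed.

Theorem theorem3p3 (phi : formula) (p : nat) (Hp : fresh p phi) :
  (CHL (fBox phi) -> CHL (fBoxb p phi)) /\
  (CHL phi -> CHL (fBoxb p phi)) /\
  (CHL (fImp (fBoxb p phi) phi) -> CHL phi).
Proof.
have box_imp : CHL (fBox phi) -> CHL (fBoxb p phi).
  by move=> h; apply: CHL_fBoxb_Loeb => //; apply: CHL_box_imp_and.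
(* Claim (ii) reduces to (i) by necessitation. *)
split=> //; split=> [/CHL_nec //|h].
(* For (iii), [h] serves twice: it reduces [phi] to [fBoxb p phi], and under the box it supplies the
   conjunct [phi]. *)
apply: CHL_mp (h); apply: CHL_fBoxb_Loeb => //.
exact/CHL_box_mono/CHL_imp_and.
Qed.
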